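(* Let $\mathbf{A}$ be a standard algebra and let $\mathcal G=\langle N,V,\{V_i\}_{i\in N},\{S_i\}_{i\in N},\{\varphi_i\}_{i\in N}\rangle$ be a finite logical $\mathbf A$-game which is weakly expressible, i.e. for each $\mathcal G$-relevant element $a$ there is a pseudo-characteristic formula $\chi_a(v)$ for $a$ in $\mathbf A$. Let $R$ be the set of $\mathcal G$-relevant elements, introduce new pairwise distinct variables $q_a$ ($a\in R$) not in $V$, write $\vec v_i=\langle v_i^1,\dots,v_i^{|V_i|}\rangle$, $\vec v=\langle\vec v_1,\dots,\vec v_n\rangle$, $\vec q=\langle q_a\rangle_{a\in R}$ (ordered by the order of $R\subseteq[0,1]$), and define $$\gamma'_{\mathcal G}(\vec v,\vec q)=\Bigl(\bigwedge_{a\in R}\chi_a(q_a)\Bigr)\wedge\Bigl(\bigwedge_{i\in N}\bigwedge_{\vec s_i\in S_i}\bigl(\varphi_i(\vec v_1,\dots,\vec v_{i-1},q_{s_i^1},\dots,q_{s_i^{|V_i|}},\vec v_{i+1},\dots,\vec v_n)\to\varphi_i(\vec v_1,\dots,\vec v_n)\bigr)\Bigr).$$ Then $\mathcal G$ has a pure Nash equilibrium if and only if the formula $$\Bigl(\bigvee_{\vec s\in S}\ \bigwedge_{i\in N}\ \bigwedge_{j\le|V_i|}\chi_{s_i^j}(v_i^j)\Bigr)\wedge\gamma'_{\mathcal G}(\vec v,\vec q)$$ is $\mathbf A$-satisfiable. Moreover, if $\mathcal G$ is full, then $\mathcal G$ has a pure Nash equilibrium if and only if $\gamma'_{\mathcal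 G}$ is $\mathbf A$-satisfiable.
   Context: A standard algebra $\mathbf A$ in a propositional language $\mathcal L_{\mathbf A}$ (connectives with arities, containing at least binary $\wedge,\vee,\to$) consists of a set $A\subseteq[0,1]$ with $1\in A$ and operations $\circ^{\mathbf A}$ on $A$ for each connective, such that for all $x,y\in A$: $x\wedge^{\mathbf A}y=1$ iff $x=y=1$; $x\vee^{\mathbf A}y=1$ iff $x=1$ or $y=1$; $x\to^{\mathbf A}y=1$ iff $x\le y$. An $\mathbf A$-evaluation maps variables into $A$ and extends to formulas; it satisfies $\varphi$ if $e(\varphi)=1$; $\varphi$ is $\mathbf A$-satisfiable if some evaluation satisfies it. $\varphi(\psi_1,\dots)$ denotes substitution; $\varphi^{\mathbf A}(a_1,\dots)$ the value of $\varphi$ when its variables take values $a_1,\dots$. A pseudo-characteristic formula for $a\in A$ is a one-variable formula $\chi_a$ with $\chi_a^{\mathbf A}(x)=1$ iff $x=a$ ($x\in A$). A logical $\mathbf A$-game $\mathcal G=\langle N,V,\{V_i\},\{S_i\},\{\varphi_i\}\rangle$: players $N=\{1,\dots,n\}$; finite set $V$ of variables partitioned into $V_1,\dots,V_n$, $V_i=\{v_i^1,\dots,v_i^{|V_i|}\}$; nonempty $S_i\subseteq A^{V_i}$ (a strategy $\vec s_i$ identified with $\langle s_i^1,\dots,s_i^{|V_i|}\rangle$, $s_i^j=\vec s_i(v_i^j)$); $\mathcal L_{\mathbf A}$-formulas $\varphi_i$ over $V$. A profile $\vec s\in S=S_1\times\dots\times S_n$ is identified with the evaluation $v_i^j\mapsto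 s_i^j$; the payoff of $i$ at $\vec s$ is $\varphi_i^{\mathbf A}(\vec s)$. $\mathcal G$ is finite if all $S_i$ are finite, full if $S_i=A^{V_i}$ for all $i$. $a\in A$ is $\mathcal G$-relevant if $a=\vec s_i(v)$ for some $i$, $v\in V_i$, $\vec s_i\in S_i$. A pure Nash equilibrium is a profile $\vec s^*$ such that no player $i$ can obtain a strictly larger payoff by replacing her component of $\vec s^*$ by another $\vec s_i\in S_i$. *)

(* Defs.v *)
(* MathComp / MathComp-Analysis *)
From HB Require Import structures.
From mathcomp Require Import all_boot all_order all_algebra finmap.
From mathcomp Require Import all_classical all_reals.

Set Implicit Arguments.
Unset Strict Implicit.
Unset Printing Implicit Defensive.

Import Order.TTheory GRing.Theory Num.Theory.
Local Open Scope classical_set_scope.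
Local Open Scope ring_scope.

(* The binary connectives /\, \/, -> belong to every language (they are
   constructors of [formula] below), so only the other ones are listed here. *)
Record language := Language {
  conn : Type;
  arity : conn -> nat }.

Notation var := nat (only parsing).

Inductive formula (L : language) : Type :=
| Var of var
| And of formula L & formula L
| Or of formula L & formula L
| Imp of formula L & formula L
| Con (c : conn L) of ('I_(arity c) -> formula L).

Arguments Var {L}.

Fixpoint occurs L (x : var) (f : formula L) : Prop :=
  match f with
  | Var y => x = y
  | And g h | Or g h | Imp g h => occurs x g \/ occurs x h
  | Con c gs => exists k, occurs x (gs k)
  end.

Fixpoint subst L (sigma : var -> formula L) (f : formula L) : formula L :=
  match f with
  | Var y => sigma y
  | And g h => And (subst sigma g) (subst sigma h)
  | Or g h => Or (subst sigma g) (subst sigma h)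
  | Imp g h => Imp (subst sigma g) (subst sigma h)
  | Con c gs => Con (fun k => subst sigma (gs k))
  end.

(* A language need not contain truth constants, so the empty conjunction is
   the tautology p -> p. *)
Definition bigAnd L (fs : seq (formula L)) : formula L :=
  if fs is f :: fs' then foldl (@And L) f fs' else Imp (Var 0%N) (Var 0%N).

(* The value on the empty list is a junk value: it is not reached below, since
   a game has at least one profile. *)
Definition bigOr L (fs : seq (formula L)) : formula L :=
  if fs is f :: fs' then foldl (@Or L) f fs' else Var 0%N.

Record standardAlgebra (R : realType) (L : language) := StandardAlgebra {
  carrier :> set R;
  carrier_sub01 : carrier `<=` [set x | 0 <= x <= 1];
  carrier_1 : carrier 1;
  and_op : carrier -> carrier -> carrier;
  or_op : carrier -> carrier -> carrier;
  imp_op : carrier -> carrier -> carrier;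
  conn_op : forall c : conn L, {ffun 'I_(arity c) -> carrier} -> carrier;
  and_opP : forall x y,
    \val (and_op x y) = 1 <-> \val x = 1 /\ \val y = 1;
  or_opP : forall x y,
    \val (or_op x y) = 1 <-> \val x = 1 \/ \val y = 1;
  imp_opP : forall x y,
    \val (imp_op x y) = 1 <-> \val x <= \val y }.

Definition top_elt R L (A : standardAlgebra R L) : A :=
  exist _ 1 (mem_set (carrier_1 A)).

Fixpoint eval R L (A : standardAlgebra R L) (e : var -> A) (f : formula L) : A :=
  match f with
  | Var x => e x
  | And g h => and_op (eval e g) (eval e h)
  | Or g h => or_op (eval e g) (eval e h)
  | Imp g h => imp_op (eval e g) (eval e h)
  | Con c gs => conn_op (c := c) [ffun k => eval e (gs k)]
  end.

Definition satisfies R L (A : standardAlgebra R L) (e : var -> A)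
    (f : formula L) : Prop :=
  \val (eval e f) = 1.

Definition satisfiable R L (A : standardAlgebra R L) (f : formula L) : Prop :=
  exists e : var -> A, satisfies e f.

Definition one_variable L (chi : formula L) : Prop :=
  exists p, forall x, occurs x chi -> x = p.

(* Since [chi] has (at most) one variable, its value when this variable takes
   the value [x] is its value under the constant evaluation, and similarly
   chi(psi) is the uniform substitution of psi. *)
Definition pseudo_characteristic R L (A : standardAlgebra R L) (a : A)
    (chi : formula L) : Prop :=
  one_variable chi /\ forall x : A, satisfies (fun=> x) chi <-> x = a.

Definition subst1 L (chi psi : formula L) : formula L := subst (fun=> psi) chi.

(* Player i owns the variables v_i^j = gvar (Tagged _ j) with j < |V_i| = nvars i;
   injectivity of [gvar] says that the V_i are disjoint and enumerated without
   repetition.  V is the range of [gvar].  A strategy in A^{V_i} is identified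
   with the tuple of its values. *)
Record game R L (A : standardAlgebra R L) := Game {
  nplayers : nat;
  nvars : 'I_nplayers -> nat;
  gvar : {i : 'I_nplayers & 'I_(nvars i)} -> var;
  gvar_inj : injective gvar;
  strat : forall i, set {ffun 'I_(nvars i) -> A};
  strat_nonempty : forall i, @strat i !=set0;
  payoff_formula : 'I_nplayers -> formula L;
  payoff_formula_over : forall i x, occurs x (payoff_formula i) -> range gvar x }.

Arguments gvar {R L A} G k : rename.
Arguments strat {R L A} G i : rename.

Section Games.
Context (R : realType) (L : language) (A : standardAlgebra R L) (G : game A).

Definition gv (i : 'I_(nplayers G)) (j : 'I_(nvars i)) : var :=
  gvar G (Tagged (fun i => 'I_(nvars i)) j).

Definition profile := {dffun forall i : 'I_(nplayers G), {ffun 'I_(nvars i) -> A}}.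

Definition profiles : set profile := [set s : profile | forall i, strat G i (s i)].

(* The evaluation v_i^j |-> s_i^j; the value outside V is irrelevant for
   formulas over V. *)
Definition profile_eval (s : forall i : 'I_(nplayers G), {ffun 'I_(nvars i) -> A})
    (x : var) : A :=
  if [pick k | gvar G k == x] is Some k then s (tag k) (tagged k)
  else top_elt A.

Definition payoff (i : 'I_(nplayers G))
    (s : forall i : 'I_(nplayers G), {ffun 'I_(nvars i) -> A}) : R :=
  \val (eval (profile_eval s) (payoff_formula i)).

Definition finite_game : Prop := forall i, finite_set (strat G i).

Definition full_game : Prop := forall i, strat G i = setT.

Definition relevant : set A :=
  [set a | exists i (j : 'I_(nvars i)),
     exists2 s, strat G i s & a = s j].

Definition weakly_expressible_by (chi : A -> formula L) : Prop :=
  forall a, relevant a -> pseudo_characteristic a (chi a).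

Definition pure_nash (s : profile) : Prop :=
  profiles s /\
  forall i si, strat G i si -> ~ (payoff i s < payoff i (dfwith s i si)).

Definition has_pure_nash : Prop := exists s, pure_nash s.

(* phi_i(v_1, ..., v_{i-1}, q_{si^1}, ..., q_{si^{|V_i|}}, v_{i+1}, ..., v_n) *)
Definition deviation_formula (q : A -> var) (i : 'I_(nplayers G))
    (si : {ffun 'I_(nvars i) -> A}) : formula L :=
  subst (fun x => if [pick j : 'I_(nvars i) | gv j == x] is Some j
                  then Var (q (si j)) else Var x)
        (payoff_formula i).

(* Finite index sets are listed, in an unspecified order, by [fset_set]. *)
Definition gamma' (chi : A -> formula L) (q : A -> var) : formula L :=
  And (bigAnd [seq subst1 (chi a) (Var (q a)) | a <- fset_set relevant])
      (bigAnd [seq bigAnd [seq Imp (deviation_formula q si) (payoff_formula i)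
                          | si <- fset_set (strat G i)]
              | i <- enum 'I_(nplayers G)]).

Definition some_profile (chi : A -> formula L) : formula L :=
  bigOr [seq bigAnd [seq bigAnd [seq subst1 (chi (s i j)) (Var (gv j))
                                | j <- enum 'I_(nvars i)]
                    | i <- enum 'I_(nplayers G)]
        | s : profile <- fset_set profiles].

End Games.

(* Main.v *)
(* A satisfying evaluation restricts on V to a profile s and, through the
   formulas chi_a(q_a), sends q_a to a.  Under it the formula
   phi_i(.., q_{s_i}, ..) takes the payoff of player i after deviating to s_i,
   so by the defining property of the implication the second part of gamma'
   says exactly that no deviation from s is profitable.  The initial disjunction
   forces s to belong to S, which is automatic for full games. *)
Require Import Defs.
From HB Require Import structures.
From mathcomp Require Import all_boot all_order all_algebra finmap.
From mathcomp Require Import all_classical all_reals.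
Local Open Scope classical_set_scope.

Set Implicit Arguments.
Unset Strict Implicit.
Unset Printing Implicit Defensive.
Import Order.TTheory.

Lemma mem_fset_setP (T : choiceType) (B : set T) (x : T) :
  finite_set B -> x \in fset_set B <-> B x.
Proof. by move=> finB; rewrite in_fset_set// inE. Qed.

(** * Substitution and iterated connectives under an evaluation *)

Section Evaluation.
Context (R : realType) (L : language) (A : standardAlgebra R L).
Implicit Types (e : nat -> A) (f g : formula L).

Lemma eval_subst e (sigma : nat -> formula L) f :
  eval e (subst sigma f) = eval (fun x => eval e (sigma x)) f.
Proof.
elim: f => //= [f -> g -> //|f -> g -> //|f -> g -> //|c fs IH].
by congr conn_op; apply/ffunP => k; rewrite !ffunE IH.
Qed.

Lemma eq_eval e e' f :
  (forall x, occurs x f -> e x = e' x) -> eval e f = eval e' f.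
Proof.
elim: f => /= [x|f IHf g IHg|f IHf g IHg|f IHf g IHg|c fs IH] ee'; first exact: ee'.
1-3: by rewrite IHf ?IHg// => x xf; apply: ee'; [right|left].
congr conn_op; apply/ffunP => k; rewrite !ffunE; apply: IH => x xk.
by apply: ee'; exists k.
Qed.

(** By the substitution lemma, [chi(x)] under [e] is [chi] under the constant evaluation [e x], the
    form in which [pseudo_characteristic] is stated. *)
Lemma satisfies_subst1_var e (a : A) (chi : formula L) (x : nat) :
  pseudo_characteristic a chi ->
  satisfies e (subst1 chi (Var x)) <-> e x = a.
Proof. by move=> [_ chiP]; rewrite /satisfies /subst1 eval_subst; exact: chiP. Qed.

Lemma satisfies_And e f g :
  satisfies e (And f g) <-> satisfies e f /\ satisfies e g.
Proof. exact: and_opP. Qed.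

Lemma satisfies_Imp e f g :
  satisfies e (Imp f g) <-> (\val (eval e f) <= \val (eval e g))%R.
Proof. exact: imp_opP. Qed.

Lemma satisfies_bigAnd (T : eqType) e (F : T -> formula L) (s : seq T) :
  satisfies e (bigAnd [seq F x | x <- s]) <->
  forall x, x \in s -> satisfies e (F x).
Proof.
(* The empty conjunction [p -> p] is satisfied by reflexivity of the order. Otherwise the first
   conjunct is the accumulator of [foldl], so the induction generalizes it to an arbitrary
   formula. *)
case: s => [|x s] /=; first by split=> // _; apply/satisfies_Imp.
have -> : satisfies e (foldl (@And L) (F x) [seq F y | y <- s]) <->
    satisfies e (F x) /\ forall y, y \in s -> satisfies e (F y).
  elim: s (F x) => [|y s IH] f /=; first by split=> [|[]].
  rewrite IH satisfies_And; split=> [[[ef ey] es]|[ef es]].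
    by split=> // z; rewrite inE => /orP[/eqP->//|/es].
  split; first by split=> //; apply: es; rewrite mem_head.
  by move=> z zs; apply: es; rewrite inE zs orbT.
split=> [[ex es] y|es]; first by rewrite inE => /orP[/eqP->//|/es].
by split=> [|y ys]; apply: es; rewrite inE ?eqxx ?ys ?orbT.
Qed.

Lemma satisfies_bigOr (T : eqType) e (F : T -> formula L) (s : seq T) :
  s <> [::] ->
  satisfies e (bigOr [seq F x | x <- s]) <->
  exists2 x, x \in s & satisfies e (F x).
Proof.
case: s => [//|x s] _ /=.
have -> : satisfies e (foldl (@Or L) (F x) [seq F y | y <- s]) <->
    satisfies e (F x) \/ exists2 y, y \in s & satisfies e (F y).
  elim: s (F x) => [|y s IH] f /=; first by split=> [|[//|[]//]]; left.
  rewrite IH /satisfies /= or_opP; split=> [[[ef|ey]|[z zs ez]]|[ef|[z]]].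
  - by left.
  - by right; exists y; rewrite ?mem_head.
  - by right; exists z; rewrite ?inE ?zs ?orbT.
  - by left; left.
  - by rewrite inE => /orP[/eqP-> ey|zs ez]; [left; right|right; exists z].
split=> [[ex|[y ys ey]]|[y]].
- by exists x; rewrite ?mem_head.
- by exists y; rewrite ?inE ?ys ?orbT.
- by rewrite inE => /orP[/eqP-> ex|ys ey]; [left|right; exists y].
Qed.

End Evaluation.

(** * Finiteness of the index sets, and payoffs as values of formulas *)

Section Game.
Context (R : realType) (L : language) (A : standardAlgebra R L) (G : game A).
Implicit Types (s : forall i : 'I_(nplayers G), {ffun 'I_(nvars i) -> A}).

Lemma profile_eval_gvar s k : profile_eval s (gvar G k) = s (tag k) (tagged k).
Proof.
rewrite /profile_eval; case: pickP => [k' /eqP/gvar_inj->//|/(_ k)].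
by rewrite eqxx.
Qed.

Lemma profile_eval_gv s i (j : 'I_(nvars i)) : profile_eval s (gv j) = s i j.
Proof. exact: profile_eval_gvar. Qed.

Lemma gv_eq_tag i (j : 'I_(nvars i)) k : gv j = gvar G k -> tag k = i.
Proof. by move=> /gvar_inj <-. Qed.

Lemma gv_inj i : injective (@gv R L A G i).
Proof.
by move=> j j' /gvar_inj/eqP; rewrite -tag_eqE /tag_eq/= eqxx tagged_asE => /eqP.
Qed.

Lemma finite_profiles : finite_game G -> finite_set (@profiles _ _ _ G).
Proof.
move=> fin_G.
(* A finite type, since each [fset_set] of strategies is one; forgetting the membership proofs maps
   it onto a superset of the profiles. *)
pose D := {dffun forall i : 'I_(nplayers G), fset_set (strat G i)}.
pose F (t : D) : profile G := [ffun i => val (t i)].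
apply: (@sub_finite_set _ _ (F @` setT)); last exact/finite_image/finite_finset.
move=> s sS.
have mem i : s i \in fset_set (strat G i) by apply/mem_fset_setP; [exact: fin_G|exact: sS].
exists ([ffun i => [` mem i]%fset] : D) => //.
by apply/ffunP => i; rewrite /F !ffunE.
Qed.

Lemma finite_relevant : finite_game G -> finite_set (relevant G).
Proof.
move=> fin_G.
pose B (i : 'I_(nplayers G)) :=
  \bigcup_(j in [set: 'I_(nvars i)]) ((fun si => si j) @` strat G i).
apply: (@sub_finite_set _ _ (\bigcup_(i in setT) B i)).
  by move=> a [i [j [si si_i ->]]]; exists i => //; exists j => //; exists si.
apply: bigcup_finite => [|i _]; first exact: finite_finset.
by apply: bigcup_finite => [|j _]; [exact: finite_finset|exact: finite_image].
Qed.

Lemma profiles_nonempty : @profiles _ _ _ G !=set0.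
Proof.
exists [ffun i => projT1 (cid (strat_nonempty i))] => i; rewrite ffunE.
exact: projT2 (cid (strat_nonempty i)).
Qed.

Lemma relevant_strat i (si : {ffun 'I_(nvars i) -> A}) j :
  strat G i si -> relevant G (si j).
Proof. by move=> siS; exists i, j, si. Qed.

(** Payoff formulas mention only variables of V, so the values of [e] elsewhere, in particular at
    the [q_a], do not affect them. *)
Lemma eval_payoff_formula e s i :
  (forall k, e (gvar G k) = s (tag k) (tagged k)) ->
  \val (eval e (payoff_formula i)) = payoff i s.
Proof.
move=> es; congr (\val _); apply: eq_eval => x /payoff_formula_over[k _ <-].
by rewrite profile_eval_gvar.
Qed.

(** By the substitution lemma this is the value of the payoff formula under an evaluation that on V
    is the deviated profile: player [i] gets [e (q (si j)) = si j], the others keep their values. *)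
Lemma eval_deviation_formula e q s i (si : {ffun 'I_(nvars i) -> A}) :
  (forall k, e (gvar G k) = s (tag k) (tagged k)) ->
  (forall j, e (q (si j)) = si j) ->
  \val (eval e (deviation_formula q si)) = payoff i (dfwith s i si).
Proof.
move=> es eq_q; rewrite /deviation_formula eval_subst.
apply: eval_payoff_formula => -[i' j].
case: pickP => [j' /eqP gvj'|no_j] /=.
  have /= ii' := gv_eq_tag gvj'; subst i'.
  by rewrite (gv_inj gvj') eq_q dfwithin.
(* A variable owned by player [i] would have been found by [pick], so the owner is another
   player. *)
rewrite es dfwithout//; apply/eqP => ii'; subst i'.
by move: (no_j j); rewrite /gv eqxx.
Qed.

(** * Meaning of the two conjuncts under an evaluation *)

Section Expressible.
Context (fin_G : finite_game G) (chi : A -> formula L)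
  (expr_G : weakly_expressible_by G chi) (q : A -> nat) (e : nat -> A).

Lemma satisfies_some_profile :
  satisfies e (some_profile G chi) <->
  exists2 s : profile G, profiles s &
    forall k, e (gvar G k) = s (tag k) (tagged k).
Proof.
have profP (s : profile G) : (s \in fset_set (@profiles _ _ _ G)) <-> profiles s.
  by apply: mem_fset_setP; exact: finite_profiles.
(* There is at least one profile, so the junk value of [bigOr] on the empty list is avoided. *)
rewrite satisfies_bigOr; last first.
  have [s /profP sS] := profiles_nonempty => nil_S.
  by have : s \in enum_fset (fset_set (@profiles _ _ _ G)) := sS; rewrite nil_S.
have conjP (s : profile G) : profiles s ->
    satisfies e (bigAnd [seq bigAnd [seq subst1 (chi (s i j)) (Var (gv j))
                                    | j <- enum 'I_(nvars i)]
                        | i <- enum 'I_(nplayers G)]) <->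
    forall k, e (gvar G k) = s (tag k) (tagged k).
  move=> sS; have chis i j := expr_G (relevant_strat j (sS i)).
  rewrite satisfies_bigAnd; split=> [es [i j]|es i _].
    have /satisfies_bigAnd/(_ j) := es i (mem_enum _ _).
    by rewrite mem_enum => /(_ isT)/(satisfies_subst1_var _ _ (chis i j)).
  apply/satisfies_bigAnd => j _.
  by apply/(satisfies_subst1_var _ _ (chis i j)); exact: es.
split=> -[s sS es]; exists s; try exact/profP; apply/conjP => //; exact/profP.
Qed.

(** Only deviations are tested here; that [s] itself is made of admissible strategies comes either
    from [some_profile] or from fullness. *)
Lemma satisfies_gamma' (s : profile G) :
  (forall k, e (gvar G k) = s (tag k) (tagged k)) ->
  satisfies e (gamma' G chi q) <->
  (forall a, relevant G a -> e (q a) = a) /\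
  forall i si, strat G i si -> ~ (payoff i s < payoff i (dfwith s i si))%R.
Proof.
move=> es; rewrite satisfies_And satisfies_bigAnd.
have -> : (forall a, a \in fset_set (relevant G) ->
      satisfies e (subst1 (chi a) (Var (q a)))) <->
    forall a, relevant G a -> e (q a) = a.
  have finR := finite_relevant fin_G.
  split=> eqa a ra.
    apply/(satisfies_subst1_var _ _ (expr_G ra)); apply: eqa.
    exact/mem_fset_setP.
  move/(mem_fset_setP _ finR) in ra.
  by apply/(satisfies_subst1_var _ _ (expr_G ra)); exact: eqa.
(* The implications express deviations only once every [q_a] has value [a], so they are analysed
   under the first conjunct. *)
suff impP : (forall a, relevant G a -> e (q a) = a) ->
    satisfies e (bigAnd [seq bigAnd
      [seq Imp (deviation_formula q si) (payoff_formula i)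
      | si <- fset_set (strat G i)] | i <- enum 'I_(nplayers G)]) <->
    forall i si, strat G i si -> ~ (payoff i s < payoff i (dfwith s i si))%R.
  by split=> -[eqa]; split=> //; exact/impP.
move=> eqa; rewrite satisfies_bigAnd.
have devP i si : strat G i si ->
    satisfies e (Imp (deviation_formula q si) (payoff_formula i)) <->
    ~ (payoff i s < payoff i (dfwith s i si))%R.
  move=> siS; rewrite satisfies_Imp (eval_payoff_formula _ es).
  rewrite (eval_deviation_formula es) => [|j]; last first.
    exact/eqa/relevant_strat.
  (* Payoffs are totally ordered, so the inequality forced by the implication is the negation of a
     strict gain. *)
  by rewrite leNgt; split=> /negP.
split=> [imp i si siS|nash i _].
  apply/devP => //; have /satisfies_bigAnd := imp i (mem_enum _ _).
  by apply; apply/mem_fset_setP; first exact: fin_G.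
apply/satisfies_bigAnd => si /(mem_fset_setP _ (fin_G i)) siS.
by apply/devP => //; exact: nash.
Qed.

End Expressible.

(** The prescriptions never conflict: [q_new] separates the [q_a] from V, and [q_inj] separates them
    from one another. *)
Lemma profile_extension (q : A -> nat) (s : profile G) :
  (forall a b, relevant G a -> relevant G b -> q a = q b -> a = b) ->
  (forall a, relevant G a -> ~ range (gvar G) (q a)) ->
  exists e : nat -> A,
    (forall k, e (gvar G k) = s (tag k) (tagged k)) /\
    (forall a, relevant G a -> e (q a) = a).
Proof.
move=> q_inj q_new.
(* It suffices to find an admissible value at each variable separately; choice then assembles the
   evaluation. *)
suff /choice [e eP] : forall x, exists a : A,
    (forall k, gvar G k = x -> a = s (tag k) (tagged k)) /\
    (forall b, relevant G b -> q b = x -> a = b).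
  exists e; split=> [k|a ra].
    by have [+ _] := eP (gvar G k); exact.
  by have [_] := eP (q a); exact.
move=> x; have [[k _ <-]|nx] := pselect (range (gvar G) x).
  exists (s (tag k) (tagged k)); split=> [k' /gvar_inj->//|b rb qb].
  by case: (q_new b rb); exists k.
have [[b [rb <-]]|nb] := pselect (exists b, relevant G b /\ q b = x).
  exists b; split=> [k qk|b' rb' qb']; last exact/esym/q_inj.
  by case: (q_new b rb); exists k.
(* Neither a game variable nor some [q_b]: any value would do. *)
exists (top_elt A); split=> [k kx|b rb qb].
  by case: nx; exists k.
by case: nb; exists b.
Qed.

End Game.

Theorem theorem3 (R : realType) (L : language) (A : standardAlgebra R L)
    (G : game A) (fin_G : finite_game G)
    (chi : A -> formula L)
    (expr_G : weakly_expressible_by G chi)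
    (q : A -> nat)
    (q_inj : forall a b, relevant G a -> relevant G b -> q a = q b -> a = b)
    (q_new : forall a, relevant G a -> ~ range (gvar G) (q a)) :
  (has_pure_nash G <->
     satisfiable A (And (some_profile G chi) (gamma' G chi q))) /\
  (full_game G ->
     (has_pure_nash G <-> satisfiable A (gamma' G chi q))).
Proof.
(* This serves both forward implications, as [gamma'] is a conjunct of the larger formula. *)
have nash_sat : has_pure_nash G ->
    satisfiable A (And (some_profile G chi) (gamma' G chi q)).
  move=> [s [sS nash]]; have [e [es eqa]] := profile_extension s q_inj q_new.
  exists e; apply/satisfies_And; split.
    by apply/satisfies_some_profile => //; exists s.
  by apply/(satisfies_gamma' fin_G expr_G q es).
split; first split=> // -[e /satisfies_And[]].
  move=> /(satisfies_some_profile fin_G expr_G)[s sS es].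
  by move=> /(satisfies_gamma' fin_G expr_G q es)[_ nash]; exists s.
move=> full_G; split=> [/nash_sat[e /satisfies_And[_ eg]]|[e eg]].
  by exists e.
(* The restriction of [e] to V; fullness makes each of its components an admissible strategy. *)
pose s : profile G := [ffun i => [ffun j : 'I_(nvars i) => e (gv j)]].
have es k : e (gvar G k) = s (tag k) (tagged k).
  by case: k => i j; rewrite /s !ffunE.
have [_ nash] := (satisfies_gamma' fin_G expr_G q es).1 eg.
by exists s; split=> // i; rewrite full_G.
Qed.
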